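(* (Discrete chain rule.) Let $F$ be a discrete analytic function defined on a patch $\mathfrak p=\{C_v,C_w\,|\,C_a,C_b\}$ with edge $e=\{C_v,C_w\}$ and image patch $\mathfrak p'=\{C'_v,C'_w\,|\,C'_a,C'_b\}$. Let $m(z)=\frac{az+b}{cz+d}$, $ad-bc=1$, be a Möbius transformation, let $\mathfrak p''=m^{-1}(\mathfrak p)$ with edge $e''=m^{-1}(e)=\{m^{-1}(C_v),m^{-1}(C_w)\}$, and let $\tau$ be the tangency point of $m^{-1}(C_v)$ and $m^{-1}(C_w)$. Assume $\tau$ and $m(\tau)$ are finite. Then the discrete Schwarzian derivative of $F\circ m:\mathfrak p''\to\mathfrak p'$ satisfies $$\Sigma_{F\circ m}(e'')=\frac{\Sigma_F(e)}{(c\tau+d)^2}=\Sigma_F(m(e''))\cdot m'(\tau).$$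
   Context: **Circles.** Circles lie on the Riemann sphere $\mathbb P=\mathbb C\cup\{\infty\}$; each circle comes with a chosen interior, an open disc. Two circles are (externally) tangent if they meet in exactly one point and their interiors are disjoint. Möbius transformations act on circles together with their interiors. For any two ordered triples of mutually tangent circles there is a unique Möbius transformation taking the first triple to the second in order. **Patches and maps.** A patch $\{C_v,C_w\,|\,C_a,C_b\}$ consists of four circles such that $\{C_v,C_w,C_a\}$ and $\{C_v,C_w,C_b\}$ are mutually tangent triples; its edge is $e=\{C_v,C_w\}$. A discrete analytic function $F$ from a patch $\{C_v,C_w\,|\,C_a,C_b\}$ to a patch $\{C'_v,C'_w\,|\,C'_a,C'_b\}$ is the correspondence $C_x\mapsto C'_x$, $x\in\{v,w,a,b\}$ (in general, discrete analytic functions are such correspondences between circle packings with the same tangency complex, restricted here to a patch). **Discrete Schwarzian derivative.** Let $m_f$ be the Möbius transformation taking $(C_v,C_w,C_a)$ to $(C'_v,C'_w,C'_a)$ and $m_g$ the one taking $(C_v,C_w,C_b)$ to $(C'_v,C'_w,C'_b)$. Let $t$ be the (finite) tangency point of $C_v$ and $C_w$. Then $m_g^{-1}\circ m_f$ is the identity or parabolic with fixed point $t$, and is represented by a matrix $$I+\sigma\begin{bmatrix}t&-t^2\\1&-t\end{bmatrix}$$ for a unique $\sigma\in\mathbb C$; one defines $\Sigma_F(e)=\sigma$. *)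

(* Defs.v *)
From mathcomp Require Import all_boot all_order all_algebra.
From mathcomp Require Export complex.
From mathcomp Require Import all_classical all_reals all_analysis.
From mathcomp Require Import ring.
Import Order.TTheory GRing.Theory Num.Theory numFieldNormedType.Exports.

Set Implicit Arguments.
Unset Strict Implicit.
Unset Printing Implicit Defensive.

Local Open Scope classical_set_scope.
Local Open Scope ring_scope.
Local Open Scope complex_scope.

Section MoebiusTransformations.
Variable K : fieldType.

(* The sphere over K: [Some z] is the finite point z and [None] is infinity. *)
Definition sphere : Type := one_point_compactification K.

(* The point with homogeneous coordinates [u : v]. *)
Definition proj_point (u v : K) : sphere :=
  if v == 0 then None else Some (u / v).

(* z |-> (M00 z + M01) / (M10 z + M11) *)
Definition lft (M : 'M[K]_2) (x : sphere) : sphere :=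
  match x with
  | Some z => proj_point (M 0 0 * z + M 0 1) (M 1 0 * z + M 1 1)
  | None => proj_point (M 0 0) (M 1 0)
  end.

Definition mx2 (a b c d : K) : 'M[K]_2 :=
  \matrix_(i < 2, j < 2)
    if i == 0 then (if j == 0 then a else b) else (if j == 0 then c else d).

(* A Moebius transformation, given by a representing matrix; proportional
   matrices are different elements of this type but have the same [mob]. *)
Record moebius := Moebius { mob_mx : 'M[K]_2; mob_unit : mob_mx \in unitmx }.

Definition mob (m : moebius) : sphere -> sphere := lft (mob_mx m).

Lemma mob_inv_subproof (m : moebius) : invmx (mob_mx m) \in unitmx.
Proof. by rewrite unitmx_inv mob_unit. Qed.

Definition mob_inv (m : moebius) : moebius := Moebius (mob_inv_subproof m).

Lemma det_mx2 (M : 'M[K]_2) : \det M = M 0 0 * M 1 1 - M 0 1 * M 1 0.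
Proof.
rewrite (expand_det_row _ 0) !big_ord_recl big_ord0 addr0 /cofactor !det_mx11.
rewrite !mxE /= expr0 expr1 mul1r mulN1r mulrN.
by congr (_ * _ - _ * _); congr (M _ _); apply/val_inj.
Qed.

Lemma proj_point_scale (k u v : K) :
  k != 0 -> proj_point (k * u) (k * v) = proj_point u v.
Proof.
move=> k0; rewrite /proj_point mulf_eq0 (negbTE k0) /=.
by case: eqVneq => // v0; rewrite -mulf_div divff ?mul1r.
Qed.

Lemma lft_proj (M : 'M[K]_2) (u v : K) : (u, v) != (0, 0) ->
  lft M (proj_point u v) =
    proj_point (M 0 0 * u + M 0 1 * v) (M 1 0 * u + M 1 1 * v).
Proof.
rewrite {1}/proj_point; have [->|v0] := eqVneq v 0.
  rewrite xpair_eqE eqxx andbT => u0 /=.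
  by rewrite !mulr0 !addr0 -(proj_point_scale _ _ u0) ![u * _]mulrC.
by move=> _ /=; rewrite -(proj_point_scale _ _ v0); congr proj_point; field.
Qed.

Lemma lft1 (x : sphere) : lft 1%:M x = x.
Proof.
case: x => [z|] /=; rewrite /proj_point !mxE /= ?mul1r ?mul0r ?addr0 ?add0r.
  by rewrite oner_eq0 divr1.
by rewrite eqxx.
Qed.

Lemma lft_mul (M N : 'M[K]_2) (x : sphere) : N \in unitmx ->
  lft (M *m N) x = lft M (lft N x).
Proof.
rewrite unitmxE unitfE det_mx2 => dN.
have mulE i j : (M *m N) i j = M i 0 * N 0 j + M i 1 * N 1 j.
  rewrite mxE !big_ord_recl big_ord0 addr0.
  by congr (M _ _ * N _ _ + M _ _ * N _ _); apply/val_inj.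
case: x => [z|]; rewrite [lft N _]/= lft_proj /= ?mulE.
- by congr proj_point; ring.
- apply: contra dN; rewrite xpair_eqE => /andP[/eqP h1 /eqP h2]; apply/eqP.
  have [e1 e2] : N 0 1 = - (N 0 0 * z) /\ N 1 1 = - (N 1 0 * z).
    by split; apply/eqP; rewrite -addr_eq0 addrC; apply/eqP.
  by rewrite e1 e2; ring.
- by [].
- apply: contra dN; rewrite xpair_eqE => /andP[/eqP h1 /eqP h2].
  by rewrite h1 h2 mul0r mulr0 subr0.
Qed.

Lemma mobK (m : moebius) : cancel (mob m) (mob (mob_inv m)).
Proof.
by move=> x; rewrite /mob -lft_mul ?mob_unit //= mulVmx ?mob_unit // lft1.
Qed.

Lemma mobVK (m : moebius) : cancel (mob (mob_inv m)) (mob m).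
Proof.
move=> x; rewrite /mob -lft_mul /= ?unitmx_inv ?mob_unit //.
by rewrite mulmxV ?mob_unit // lft1.
Qed.

Lemma mob_inj (m : moebius) : injective (mob m).
Proof. exact: can_inj (mobK m). Qed.

End MoebiusTransformations.

Section Circles.
Variable R : realType.
Local Notation C := R[i].
Local Notation P := (sphere C).
Local Notation Re := (@complex.Re R).
Local Notation Im := (@complex.Im R).

(* The equation A |z|^2 + 2 Re (B z) + D = 0 describes, when A D < |B|^2, a
   Euclidean circle if A <> 0 and a line (through infinity) if A = 0. The two
   complementary discs are the sides where the form is negative and positive;
   negating (A, B, D) exchanges them. *)
Definition circle_form (A : R) (B : C) (D : R) (x : P) : R :=
  match x with
  | Some z => A * (Re z ^+ 2 + Im z ^+ 2) + 2 * Re (B * z) + D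
  | None => A
  end.

Definition is_circle (S I : set P) : Prop :=
  exists (A : R) (B : C) (D : R),
    [/\ A * D < Re B ^+ 2 + Im B ^+ 2,
        S = [set x | circle_form A B D x = 0] &
        I = [set x | circle_form A B D x < 0]].

(* A circle with a chosen interior. *)
Record circle := Circle {
  locus : set P;
  interior_disc : set P;
  circleP : is_circle locus interior_disc }.

(* The Hermitian form obtained by homogenizing [circle_form]: z = u / v. *)
Definition hform (A : R) (B : C) (D : R) (u v : C) : R :=
  A * (Re u ^+ 2 + Im u ^+ 2) + 2 * Re (B * u * v^*%C)
  + D * (Re v ^+ 2 + Im v ^+ 2).

Lemma circle_form_proj A B D (u v : C) : (u, v) != (0, 0) ->
  exists2 k : R, 0 < k & hform A B D u v = k * circle_form A B D (proj_point u v).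
Proof.
rewrite /proj_point; have [->|v0] := eqVneq v 0.
  rewrite xpair_eqE eqxx andbT => u0; exists (Re u ^+ 2 + Im u ^+ 2).
    case: u u0 => x y; rewrite eq_complex /= negb_and => h.
    rewrite lt_neqAle addr_ge0 ?sqr_ge0 // andbT eq_sym.
    by rewrite paddr_eq0 ?sqr_ge0 // !sqrf_eq0 negb_and.
  by case: u u0 => x y _; case: B => b1 b2; rewrite /hform /=; ring.
move=> _; exists (Re v ^+ 2 + Im v ^+ 2).
  case: v v0 => x y; rewrite eq_complex /= negb_and => h.
  rewrite lt_neqAle addr_ge0 ?sqr_ge0 // andbT eq_sym.
  by rewrite paddr_eq0 ?sqr_ge0 // !sqrf_eq0 negb_and.
have -> : u = (u / v) * v by rewrite divfK.
move: (u / v) => z; rewrite mulfK //.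
by case: z v v0 B => [z1 z2] [v1 v2] _ [b1 b2]; rewrite /hform /=; ring.
Qed.

Lemma is_circle_preimage (M : 'M[C]_2) (S I : set P) : M \in unitmx ->
  is_circle S I -> is_circle (lft M @^-1` S) (lft M @^-1` I).
Proof.
rewrite unitmxE unitfE det_mx2 => dM [A [B [D [hd -> ->]]]].
set a := M 0 0; set b := M 0 1; set c := M 1 0; set d := M 1 1.
pose A' := hform A B D a c; pose D' := hform A B D b d.
pose B' : C := (A%:C * a * b^*%C + B * a * d^*%C + (B * b)^*%C * c
   + D%:C * c * d^*%C).
have hE (u v : C) : hform A B D (a * u + b * v) (c * u + d * v) =
    hform A' B' D' u v.
  rewrite /A' /D' /B' /hform.
  case: (a) (b) (c) (d) => [a1 a2] [b1 b2] [c1 c2] [d1 d2].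
  by case: u v (B) => [u1 u2] [v1 v2] [e1 e2] /=; ring.
have hk (x : P) : exists2 k : R, 0 < k &
    circle_form A' B' D' x = k * circle_form A B D (lft M x).
  case: x => [z|].
    have nz : (a * z + b, c * z + d) != (0, 0).
      apply: contra dM; rewrite xpair_eqE => /andP[/eqP h1 /eqP h2]; apply/eqP.
      have [e1 e2] : b = - (a * z) /\ d = - (c * z).
        by split; apply/eqP; rewrite -addr_eq0 addrC; apply/eqP.
      by rewrite -/a -/b -/c -/d e1 e2; ring.
    have [k k0 hk] := circle_form_proj A B D nz; exists k => //=.
    rewrite -/a -/b -/c -/d -hk -{1}[b]mulr1 -{1}[d]mulr1 hE /hform.
    by case: z {nz hk} => z1 z2; case: (B') => e1 e2 /=; ring.
  have nz : (a, c) != (0, 0).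
    apply: contra dM; rewrite xpair_eqE => /andP[/eqP h1 /eqP h2].
    by rewrite -/a -/b -/c -/d h1 h2 mul0r mulr0 subr0.
  by have [k k0 hk] := circle_form_proj A B D nz; exists k.
exists A', B', D'; split.
- have -> : A' * D' = Re B' ^+ 2 + Im B' ^+ 2 -
     (Re (a * d - b * c) ^+ 2 + Im (a * d - b * c) ^+ 2) *
     (Re B ^+ 2 + Im B ^+ 2 - A * D).
    rewrite /A' /D' /B' /hform.
    case: (a) (b) (c) (d) => [a1 a2] [b1 b2] [c1 c2] [d1 d2].
    by case: (B) => [e1 e2] /=; ring.
  rewrite ltrBlDr ltrDl mulr_gt0 ?subr_gt0 //.
  move: dM; rewrite -/a -/b -/c -/d; case: (a * d - b * c) => x y.
  rewrite eq_complex /= negb_and => h.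
  rewrite lt_neqAle addr_ge0 ?sqr_ge0 // andbT eq_sym.
  by rewrite paddr_eq0 ?sqr_ge0 // !sqrf_eq0 negb_and.
- apply/seteqP; split=> x /=; have [k k0 ->] := hk x.
    by move=> ->; rewrite mulr0.
  by move/eqP; rewrite mulf_eq0 gt_eqF //= => /eqP.
- apply/seteqP; split=> x /=; have [k k0 ->] := hk x.
    by rewrite pmulr_rlt0.
  by rewrite pmulr_rlt0.
Qed.

Lemma mob_image (m : moebius C) (S : set P) :
  mob m @` S = lft (mob_mx (mob_inv m)) @^-1` S.
Proof.
apply/seteqP; split=> x /=.
  by move=> [y Sy <-]; rewrite -/(mob (mob_inv m) _) mobK.
by move=> Sx; exists (mob (mob_inv m) x) => //; rewrite mobVK.
Qed.

Lemma mob_circle_subproof (m : moebius C) (c : circle) :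
  is_circle (mob m @` locus c) (mob m @` interior_disc c).
Proof.
by rewrite !mob_image; apply/is_circle_preimage/circleP/mob_unit.
Qed.

Definition mob_circle (m : moebius C) (c : circle) : circle :=
  Circle (mob_circle_subproof m c).

Definition tangency_point (c1 c2 : circle) (x : P) : Prop :=
  locus c1 `&` locus c2 = [set x].

Definition tangent (c1 c2 : circle) : Prop :=
  (exists x, tangency_point c1 c2 x) /\
  interior_disc c1 `&` interior_disc c2 = set0.

Definition mutually_tangent (c1 c2 c3 : circle) : Prop :=
  [/\ tangent c1 c2, tangent c2 c3 & tangent c1 c3].

Lemma mob_tangent (m : moebius C) (c1 c2 : circle) :
  tangent c1 c2 -> tangent (mob_circle m c1) (mob_circle m c2).
Proof.
have imI (A B : set P) : mob m @` A `&` mob m @` B = mob m @` (A `&` B).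
  apply/seteqP; split=> [x [[y Ay <-]] [z Bz /mob_inj zy]|_ [y [Ay By] <-]].
    by exists y => //; split=> //; rewrite -zy.
  by split; exists y.
move=> [[x hx] h0]; split.
  by exists (mob m x); rewrite /tangency_point /= imI hx image_set1.
by rewrite /= imI h0 image_set0.
Qed.

Lemma mob_mutually_tangent (m : moebius C) (c1 c2 c3 : circle) :
  mutually_tangent c1 c2 c3 ->
  mutually_tangent (mob_circle m c1) (mob_circle m c2) (mob_circle m c3).
Proof. by move=> [h1 h2 h3]; split; exact: mob_tangent. Qed.

(* The patch {cv, cw | ca, cb}. *)
Record patch := Patch {
  cv : circle; cw : circle; ca : circle; cb : circle;
  patch_a : mutually_tangent cv cw ca;
  patch_b : mutually_tangent cv cw cb }.

Definition edge (p : patch) : set circle := [set cv p; cw p].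

Definition mob_patch (m : moebius C) (p : patch) : patch :=
  Patch (mob_mutually_tangent m (patch_a p))
        (mob_mutually_tangent m (patch_b p)).

(* The correspondence cx (source F) |-> cx (target F), x in {v, w, a, b}. The
   labels matter: ca and cb of the source may be the same circle. *)
Record discrete_analytic := DiscreteAnalytic { source : patch; target : patch }.

(* F \o m, defined on the patch m^-1 (source F). *)
Definition comp_mob (F : discrete_analytic) (m : moebius C) :
    discrete_analytic :=
  DiscreteAnalytic (mob_patch (mob_inv m) (source F)) (target F).

Definition takes_triple (m : moebius C) (c1 c2 c3 c1' c2' c3' : circle) : Prop :=
  [/\ mob_circle m c1 = c1', mob_circle m c2 = c2' & mob_circle m c3 = c3'].

(* sigma is the discrete Schwarzian derivative of F at the edge e. *)
Definition is_schwarzian (F : discrete_analytic) (e : set circle) (sigma : C) :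
    Prop :=
  let p := source F in let p' := target F in
  e = edge p /\
  exists (t : C) (mf mg : moebius C),
    [/\ tangency_point (cv p) (cw p) (Some t),
        takes_triple mf (cv p) (cw p) (ca p) (cv p') (cw p') (ca p'),
        takes_triple mg (cv p) (cw p) (cb p) (cv p') (cw p') (cb p') &
        mob (mob_inv mg) \o mob mf =
          lft (1%:M + sigma *: mx2 t (- t ^+ 2) 1 (- t))].

(* The value 0 is a junk value, used only when no number qualifies: e is not the
   edge of the source of F, or its tangency point is infinity. *)
Definition schwarzian (F : discrete_analytic) (e : set circle) : C :=
  xget 0 [set sigma | is_schwarzian F e sigma].

End Circles.

(* Main.v *)
(** The number sigma is well defined because a Moebius transformation is
    determined by its action on three mutually tangent circles: the three
    tangency points are distinct (if they coincided, sending them to infinity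
    would give three parallel lines bounding pairwise disjoint half-planes), and
    a Moebius transformation with three fixed points is the identity.
    Precomposing F with m replaces m_g^-1 m_f by its conjugate
    m^-1 (m_g^-1 m_f) m, and conjugating the parabolic matrix with fixed point
    m(tau) by m gives the one with fixed point tau and with sigma divided by
    (c tau + d)^2. *)

Require Import Defs.
From mathcomp Require Import all_boot all_order all_algebra complex.
From mathcomp Require Import all_classical all_reals all_analysis.
From mathcomp Require Import ring lra.
Import Order.TTheory GRing.Theory Num.Theory numFieldNormedType.Exports.
Local Open Scope classical_set_scope.
Local Open Scope ring_scope.

(** * Two-by-two matrices, parabolics and fixed points on the sphere *)

Section Moebius.
Set Implicit Arguments.
Unset Strict Implicit.

Context {K : fieldType}.

Lemma matrix2P (M N : 'M[K]_2) :
  M 0 0 = N 0 0 -> M 0 1 = N 0 1 -> M 1 0 = N 1 0 -> M 1 1 = N 1 1 -> M = N.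
Proof.
move=> h00 h01 h10 h11; apply/matrixP => i j.
have two (k : 'I_2) : k = 0 \/ k = 1.
  by case: k => [[|[|k]] hk] //; [left|right]; apply/val_inj.
by case: (two i) => ->; case: (two j) => ->.
Qed.

Lemma mulmx2E (M N : 'M[K]_2) i j :
  (M *m N) i j = M i 0 * N 0 j + M i 1 * N 1 j.
Proof.
rewrite mxE !big_ord_recl big_ord0 addr0.
by congr (M _ _ * N _ _ + M _ _ * N _ _); apply/val_inj.
Qed.

Lemma mx2E (a b c d : K) :
  (mx2 a b c d 0 0 = a) * (mx2 a b c d 0 1 = b) *
  (mx2 a b c d 1 0 = c) * (mx2 a b c d 1 1 = d).
Proof. by rewrite !mxE. Qed.

Lemma parabolicE (s t : K) :
  1%:M + s *: mx2 t (- t ^+ 2) 1 (- t) =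
  mx2 (1 + s * t) (- (s * t ^+ 2)) s (1 - s * t).
Proof.
by apply: matrix2P; rewrite !mxE /=; ring.
Qed.

Lemma parabolic_unit (s t : K) :
  1%:M + s *: mx2 t (- t ^+ 2) 1 (- t) \in unitmx.
Proof.
rewrite parabolicE unitmxE unitfE det_mx2 !mx2E.
suff -> : (1 + s * t) * (1 - s * t) - - (s * t ^+ 2) * s = 1 by exact: oner_neq0.
by ring.
Qed.

(* The image of infinity is t + 1 / s, so it determines s. *)
Lemma parabolic_inj (t s1 s2 : K) :
  lft (1%:M + s1 *: mx2 t (- t ^+ 2) 1 (- t)) =
  lft (1%:M + s2 *: mx2 t (- t ^+ 2) 1 (- t)) -> s1 = s2.
Proof.
move=> /(congr1 (fun f => f None)); rewrite !parabolicE /= !mx2E /proj_point.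
case: eqVneq => [->|n1]; case: eqVneq => [->|n2] // [] h.
apply: (can_inj (@invrK K)).
suff E (s : K) : s != 0 -> s^-1 = (1 + s * t) / s - t by rewrite (E _ n1) h -E.
by move=> s0; field.
Qed.

Lemma mob_comp_subproof (m n : moebius K) : mob_mx m *m mob_mx n \in unitmx.
Proof. by rewrite unitmx_mul !mob_unit. Qed.

Definition mob_comp (m n : moebius K) : moebius K :=
  Moebius (mob_comp_subproof m n).

Lemma mob_compE (m n : moebius K) : mob (mob_comp m n) = mob m \o mob n.
Proof. by apply/funext => x; rewrite /mob lft_mul ?mob_unit. Qed.

Lemma proj_point_fixed (u v z : K) :
  proj_point u v = Some z -> v != 0 /\ u = z * v.
Proof.
by rewrite /proj_point; case: eqVneq => // v0 [<-]; rewrite divfK.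
Qed.

(* Fixed points are the zeros of the form M10 u^2 + (M11 - M00) u v - M01 v^2,
   which vanishes identically only if M is scalar. *)
Lemma lft_fixed_form (M : 'M[K]_2) (z : K) : lft M (Some z) = Some z ->
  M 1 0 * z ^+ 2 + (M 1 1 - M 0 0) * z - M 0 1 = 0.
Proof.
move=> /proj_point_fixed[_ h].
have -> : M 0 1 = z * (M 1 0 * z + M 1 1) - M 0 0 * z by rewrite -h; ring.
by ring.
Qed.

Lemma lft_fixed_inf (M : 'M[K]_2) : lft M None = None -> M 1 0 = 0.
Proof. by rewrite /= /proj_point; case: eqVneq. Qed.

Lemma lft_scalar (M : 'M[K]_2) : M \in unitmx ->
  M 1 0 = 0 -> M 1 1 = M 0 0 -> M 0 1 = 0 -> lft M =1 id.
Proof.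
rewrite unitmxE unitfE det_mx2 => dM h10 h11 h01.
have k0 : M 0 0 != 0.
  by apply: contra dM => /eqP; rewrite h11 h10 => ->; rewrite mul0r mulr0 subr0.
case=> [z|]; rewrite /= h10 ?h11 ?h01 /proj_point ?mul0r ?add0r ?addr0 ?eqxx //.
by rewrite (negbTE k0) mulrC mulKf.
Qed.

(** Fixing infinity removes the quadratic term of the fixed-point form; the remaining affine form
    has two zeros, so it vanishes. *)
Lemma lft_fixed3_inf (M : 'M[K]_2) (x y : K) : M \in unitmx -> x != y ->
  lft M None = None -> lft M (Some x) = Some x -> lft M (Some y) = Some y ->
  lft M =1 id.
Proof.
rewrite -subr_eq0 => uM xy /lft_fixed_inf h0.
move=> /lft_fixed_form hx /lft_fixed_form hy.
have h1 : M 1 1 - M 0 0 = 0.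
  apply: (mulIf xy); rewrite mul0r.
  have <- : 0 - 0 = 0 :> K by rewrite subrr.
  by rewrite -{1}hx -hy h0; ring.
move: hx; rewrite h0 h1 !mul0r !add0r => /eqP; rewrite oppr_eq0 => /eqP h2.
by apply: lft_scalar => //; apply/eqP; rewrite -subr_eq0 h1.
Qed.

(** Repeated divided differences of the fixed-point form at its three distinct zeros kill its
    coefficients one after another. *)
Lemma lft_fixed3_finite (M : 'M[K]_2) (x y z : K) : M \in unitmx ->
  x != y -> x != z -> y != z ->
  lft M (Some x) = Some x -> lft M (Some y) = Some y -> lft M (Some z) = Some z ->
  lft M =1 id.
Proof.
rewrite -subr_eq0 -(subr_eq0 x z) -(subr_eq0 y z) => uM xy xz yz.
move=> /lft_fixed_form hx /lft_fixed_form hy /lft_fixed_form hz.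
set p := M 1 0 in hx hy hz; set q := M 1 1 - M 0 0 in hx hy hz.
have hxy : p * (x + y) + q = 0.
  apply: (mulIf xy); rewrite mul0r.
  have <- : 0 - 0 = 0 :> K by rewrite subrr.
  by rewrite -{1}hx -hy; ring.
have hxz : p * (x + z) + q = 0.
  apply: (mulIf xz); rewrite mul0r.
  have <- : 0 - 0 = 0 :> K by rewrite subrr.
  by rewrite -{1}hx -hz; ring.
have p0 : p = 0.
  apply: (mulIf yz); rewrite mul0r.
  have <- : 0 - 0 = 0 :> K by rewrite subrr.
  by rewrite -{1}hxy -hxz; ring.
have q0 : q = 0 by move: hxy; rewrite p0 mul0r add0r.
move: hx; rewrite p0 q0 !mul0r !add0r => /eqP; rewrite oppr_eq0 => /eqP r0.
by apply: lft_scalar => //; apply/eqP; rewrite -subr_eq0 -/q q0.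
Qed.

Lemma lft_fixed3 (M : 'M[K]_2) (x y z : sphere K) : M \in unitmx ->
  x <> y -> x <> z -> y <> z ->
  lft M x = x -> lft M y = y -> lft M z = z -> lft M =1 id.
Proof.
have neqS (u v : K) : Some u <> Some v :> sphere K -> u != v.
  by move=> h; apply/eqP => uv; apply: h; rewrite uv.
case: x y z => [x|] [y|] [z|] // uM xy xz yz hx hy hz.
- by apply: (@lft_fixed3_finite M x y z) => //; exact: neqS.
- by apply: (@lft_fixed3_inf M x y) => //; exact: neqS.
- by apply: (@lft_fixed3_inf M x z) => //; exact: neqS.
- by apply: (@lft_fixed3_inf M y z) => //; exact: neqS.
Qed.

End Moebius.

(** * Tangent circles and rigidity of mutually tangent triples *)

Section Tangency.
Set Implicit Arguments.
Unset Strict Implicit.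

Context {R : realType}.
Local Notation C := R[i].
Implicit Types (c : circle R) (m n : moebius C).

Lemma circle_ext c1 c2 :
  locus c1 = locus c2 -> interior_disc c1 = interior_disc c2 -> c1 = c2.
Proof.
case: c1 c2 => [S1 I1 p1] [S2 I2 p2] /= hS hI.
by subst; congr Circle; exact: Prop_irrelevance.
Qed.

Lemma tangency_point_mob m c1 c2 x : tangency_point c1 c2 x ->
  tangency_point (mob_circle m c1) (mob_circle m c2) (mob m x).
Proof.
rewrite /tangency_point /= => h; rewrite -(image_set1 (mob m)) -h.
rewrite eqEsubset; split=> [_ [[y h1 <-] [z h2 /mob_inj zy]]|_ [y [h1 h2] <-]].
  by exists y => //; split=> //; rewrite -zy.
by split; exists y.
Qed.

Lemma tangency_point_uniq c1 c2 x y :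
  tangency_point c1 c2 x -> tangency_point c1 c2 y -> x = y.
Proof. by rewrite /tangency_point => -> /seteqP[+ _]; apply. Qed.

(** The case [A = 0] of [circle_form] in real coordinates; [(b1, b2)] is a normal pointing out of
    the interior. *)
Definition is_line c (b1 b2 e : R) : Prop :=
  [/\ 0 < b1 ^+ 2 + b2 ^+ 2,
      forall x y : R, locus c (Some (Complex x y)) <-> b1 * x + b2 * y + e = 0 &
      forall x y : R, interior_disc c (Some (Complex x y)) <->
        b1 * x + b2 * y + e < 0].

Lemma is_line_inf c : locus c None -> exists b1 b2 e : R, is_line c b1 b2 e.
Proof.
case: (circleP c) => A [[b1 b2] [D [hd hS hI]]]; rewrite hS /= => A0; subst A.
exists (2 * b1), (- 2 * b2), D; split => [|x y|x y].
- move: hd; rewrite mul0r /= => hd.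
  rewrite (_ : _ + _ = 4 * (b1 ^+ 2 + b2 ^+ 2)); last by ring.
  by rewrite mulr_gt0 // ltr0n.
- rewrite hS /= (_ : _ + D = 2 * b1 * x + - 2 * b2 * y + D) //; ring.
- rewrite hI /= (_ : _ + D = 2 * b1 * x + - 2 * b2 * y + D) //; ring.
Qed.

(** The lines already meet at infinity, so a finite common point would be a second one; outward
    normals at an acute angle would make the half-planes overlap. *)
Lemma tangent_lines c1 c2 (a1 a2 d b1 b2 e : R) :
  tangent c1 c2 -> locus c1 None -> locus c2 None ->
  is_line c1 a1 a2 d -> is_line c2 b1 b2 e ->
  a1 * b2 - a2 * b1 = 0 /\ a1 * b1 + a2 * b2 <= 0.
Proof.
move=> [[t ht] h0] i1 i2 [n1 l1 j1] [n2 l2 j2]; split.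
  apply/eqP; apply: contraT => n0.
  (* Cramer's rule for the common point of the two lines. *)
  pose x := (a2 * e - b2 * d) / (a1 * b2 - a2 * b1).
  pose y := (b1 * d - a1 * e) / (a1 * b2 - a2 * b1).
  have : [set t] (Some (Complex x y)).
    rewrite -ht; split; first by apply/l1; rewrite /x /y; field.
    by apply/l2; rewrite /x /y; field.
  have : [set t] None by rewrite -ht.
  by move=> /= <-.
rewrite leNgt; apply/negP => p0.
(* Far out in the direction - (a1, a2) both forms are negative. *)
set N := a1 ^+ 2 + a2 ^+ 2 in n1; set p := a1 * b1 + a2 * b2 in p0.
(* The first summand makes [k * N] exceed [d], the second makes [k * p] exceed [e]. *)
pose k := (`|d| + 1) / N + (`|e| + 1) / p.
have kN : `|d| + 1 <= k * N.
  rewrite /k mulrDl divfK ?gt_eqF // lerDl.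
  by apply: mulr_ge0; [apply: divr_ge0; [exact: addr_ge0|]|]; exact: ltW.
have kp : `|e| + 1 <= k * p.
  rewrite /k mulrDl divfK ?gt_eqF // lerDr.
  by apply: mulr_ge0; [apply: divr_ge0; [exact: addr_ge0|]|]; exact: ltW.
have /seteqP[/(_ (Some (Complex (- k * a1) (- k * a2)))) + _] := h0.
apply; split.
  apply/j1; rewrite (_ : _ + d = d - k * N); last by rewrite /N; ring.
  by have := ler_norm d; lra.
apply/j2; rewrite (_ : _ + e = e - k * p); last by rewrite /p; ring.
by have := ler_norm e; lra.
Qed.

(** Three nonzero parallel normals cannot be pairwise opposite. *)
Lemma mutually_tangent_notin_inf c1 c2 c3 : mutually_tangent c1 c2 c3 ->
  locus c1 None -> locus c2 None -> ~ locus c3 None.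
Proof.
move=> [t12 t23 t13] h1 h2 h3.
have [a1 [a2 [a la]]] := is_line_inf h1.
have [b1 [b2 [b lb]]] := is_line_inf h2.
have [d1 [d2 [d ld]]] := is_line_inf h3.
have [x12 p12] := tangent_lines t12 h1 h2 la lb.
have [_ p23] := tangent_lines t23 h2 h3 lb ld.
have [x13 p13] := tangent_lines t13 h1 h3 la ld.
case: la lb ld => na _ _ [nb _ _] [nd _ _].
set p := a1 * b1 + a2 * b2 in p12; set q := a1 * d1 + a2 * d2 in p13.
have lagrange (u1 u2 v1 v2 : R) : u1 * v2 - u2 * v1 = 0 ->
    0 < u1 ^+ 2 + u2 ^+ 2 -> 0 < v1 ^+ 2 + v2 ^+ 2 -> u1 * v1 + u2 * v2 != 0.
  move=> x0 nu nv; rewrite -sqrf_eq0 gt_eqF //.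
  rewrite (_ : _ ^+ 2 = (u1 ^+ 2 + u2 ^+ 2) * (v1 ^+ 2 + v2 ^+ 2)
     - (u1 * v2 - u2 * v1) ^+ 2); last by ring.
  by rewrite x0 expr0n subr0 mulr_gt0.
have p0 : p < 0 by rewrite lt_neqAle p12 andbT lagrange.
have q0 : q < 0 by rewrite lt_neqAle p13 andbT lagrange.
have : 0 < p * q by rewrite nmulr_rgt0.
(* By [x12] the last product vanishes, so [b1 * d1 + b2 * d2] has the sign of [p * q], against
   [p23]. *)
rewrite (_ : p * q = (a1 ^+ 2 + a2 ^+ 2) * (b1 * d1 + b2 * d2) -
   (a1 * b2 - a2 * b1) * (a1 * d2 - a2 * d1)); last by rewrite /p /q; ring.
by rewrite x12 mul0r subr0 pmulr_rgt0 // ltNge p23.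
Qed.

Lemma mutually_tangent_notin c1 c2 c3 x : mutually_tangent c1 c2 c3 ->
  locus c1 x -> locus c2 x -> ~ locus c3 x.
Proof.
case: x => [z|]; last exact: mutually_tangent_notin_inf.
move=> tc h1 h2 h3.
(* The matrix of [w |-> 1 / (w - z)], which sends [z] to infinity. *)
have uM : mx2 0 1 1 (- z) \in unitmx.
  rewrite unitmxE unitfE det_mx2 !mx2E mul0r mulr1 sub0r.
  by rewrite oppr_eq0 oner_neq0.
pose m := Moebius uM.
have mz : mob m (Some z) = None.
  by rewrite /mob /= !mx2E mul1r subrr /proj_point eqxx.
by apply: (mutually_tangent_notin_inf (mob_mutually_tangent m tc)); exists (Some z).
Qed.

(** Each tangency point is determined by its two circles, hence fixed; if two of them coincided,
    that point would lie on all three circles. *)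
Lemma mob_fix_triple m c1 c2 c3 : mutually_tangent c1 c2 c3 ->
  mob_circle m c1 = c1 -> mob_circle m c2 = c2 -> mob_circle m c3 = c3 ->
  mob m =1 id.
Proof.
move=> tc h1 h2 h3; have no x := @mutually_tangent_notin _ _ _ x tc.
have [[[x hx] _] [[y hy] _] [[z hz] _]] := tc.
have fx : mob m x = x.
  by apply: (tangency_point_uniq _ hx); have := tangency_point_mob m hx; rewrite h1 h2.
have fy : mob m y = y.
  by apply: (tangency_point_uniq _ hy); have := tangency_point_mob m hy; rewrite h2 h3.
have fz : mob m z = z.
  by apply: (tangency_point_uniq _ hz); have := tangency_point_mob m hz; rewrite h1 h3.
have [x1 x2] : (locus c1 `&` locus c2) x by rewrite hx.
have [y2 y3] : (locus c2 `&` locus c3) y by rewrite hy.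
have [z1 z3] : (locus c1 `&` locus c3) z by rewrite hz.
apply: (lft_fixed3 (mob_unit m) _ _ _ fx fy fz) => E.
- by apply: (no x) => //; rewrite E.
- by apply: (no x) => //; rewrite E.
- by apply: (no y) => //; rewrite E.
Qed.

Lemma mob_circle_comp m n c :
  mob_circle (mob_comp m n) c = mob_circle m (mob_circle n c).
Proof. by apply: circle_ext; rewrite /= mob_compE image_comp. Qed.

Lemma mob_circle_id m c : mob m =1 id -> mob_circle m c = c.
Proof. by move=> /funext h; apply: circle_ext; rewrite /= h image_id. Qed.

Lemma mob_circleK m : cancel (mob_circle m) (mob_circle (mob_inv m)).
Proof.
move=> c; rewrite -mob_circle_comp mob_circle_id // => x.
by rewrite mob_compE /= mobK.
Qed.

Lemma mob_circleVK m : cancel (mob_circle (mob_inv m)) (mob_circle m).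
Proof.
move=> c; rewrite -mob_circle_comp mob_circle_id // => x.
by rewrite mob_compE /= mobVK.
Qed.

Lemma takes_triple_uniq m n c1 c2 c3 c1' c2' c3' : mutually_tangent c1 c2 c3 ->
  takes_triple m c1 c2 c3 c1' c2' c3' -> takes_triple n c1 c2 c3 c1' c2' c3' ->
  mob m = mob n.
Proof.
move=> tc [m1 m2 m3] [n1 n2 n3].
have fixed c c' : mob_circle m c = c' -> mob_circle n c = c' ->
    mob_circle (mob_comp (mob_inv n) m) c = c.
  by move=> mc nc; rewrite mob_circle_comp mc -nc mob_circleK.
have k1 := mob_fix_triple tc (fixed _ _ m1 n1) (fixed _ _ m2 n2) (fixed _ _ m3 n3).
apply/funext => x; have := k1 x; rewrite mob_compE /= => /(congr1 (mob n)).
by rewrite mobVK.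
Qed.

(** Not a mere congruence: equal maps may have different, proportional matrices. *)
Lemma mob_inv_eq m n : mob m = mob n -> mob (mob_inv m) = mob (mob_inv n).
Proof.
by move=> h; apply/funext => x; apply: (@mob_inj _ m); rewrite mobVK h mobVK.
Qed.

(** * Uniqueness of sigma and its change under precomposition *)

Lemma is_schwarzian_uniq (F : discrete_analytic R) e s1 s2 :
  is_schwarzian F e s1 -> is_schwarzian F e s2 -> s1 = s2.
Proof.
move=> [_ [t [mf [mg [ht hf hg E]]]]] [_ [t' [mf' [mg' [ht' hf' hg' E']]]]].
have [tt] := tangency_point_uniq ht ht'; subst t'.
apply: (@parabolic_inj _ t); rewrite -E -E'.
have -> := takes_triple_uniq (patch_a (source F)) hf hf'.
by rewrite (mob_inv_eq (takes_triple_uniq (patch_b (source F)) hg hg')).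
Qed.

Lemma schwarzianE (F : discrete_analytic R) e s :
  is_schwarzian F e s -> schwarzian F e = s.
Proof.
move=> h; rewrite /schwarzian; apply: xget_unique => // s' /is_schwarzian_uniq.
exact.
Qed.

Lemma schwarzian_junk (F : discrete_analytic R) e :
  ~ (exists s, is_schwarzian F e s) -> schwarzian F e = 0.
Proof.
by move=> h; rewrite /schwarzian; case: xgetP => // s _ hs; case: h; exists s.
Qed.

(* The parabolic with fixed point t is I + sigma (t, 1)^T (1, -t). For t = m tau,
   M^-1 sends (t, 1)^T to (tau, 1)^T / (c tau + d), and (1, -t) M is
   \det M (1, -tau) / (c tau + d). *)
Lemma parabolic_conj (M : 'M[C]_2) (s t tau : C) :
  lft M (Some tau) = Some t ->
  let s' := s * \det M / (M 1 0 * tau + M 1 1) ^+ 2 in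
  (1%:M + s *: mx2 t (- t ^+ 2) 1 (- t)) *m M =
  M *m (1%:M + s' *: mx2 tau (- tau ^+ 2) 1 (- tau)).
Proof.
move=> /proj_point_fixed[v0 E] /=.
have -> : t = (M 0 0 * tau + M 0 1) / (M 1 0 * tau + M 1 1).
  by rewrite E mulfK.
rewrite !parabolicE det_mx2.
by apply: matrix2P; rewrite !mulmx2E !mx2E; field.
Qed.

(** Allows the composition rule to be run backwards, from [F \o m] to [F]. *)
Lemma discrete_analytic_comp_mobK (F : discrete_analytic R) m :
  comp_mob (comp_mob F m) (mob_inv m) = F.
Proof.
have circleVV c : mob_circle (mob_inv (mob_inv m)) (mob_circle (mob_inv m) c) = c.
  by rewrite mob_circleK.
case: F => [[c1 c2 c3 c4 pa pb] p']; rewrite /comp_mob /=.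
congr DiscreteAnalytic; rewrite /mob_patch /=.
(* The tangency proofs are generalized first, since their types mention the circles to be
   rewritten. *)
move: (mob_mutually_tangent _ _) (mob_mutually_tangent _ _) => qa qb.
move: qa qb; rewrite !circleVV => qa qb.
by congr Patch; exact: Prop_irrelevance.
Qed.

(** The determinant is kept in the formula so that the rule applies directly to [mob_inv m] as
    well. *)
Lemma is_schwarzian_comp (F : discrete_analytic R) m (s tau : C) :
  is_schwarzian F (edge (source F)) s ->
  tangency_point (cv (source (comp_mob F m))) (cw (source (comp_mob F m)))
    (Some tau) ->
  is_schwarzian (comp_mob F m) (edge (source (comp_mob F m)))
    (s * \det (mob_mx m) / (mob_mx m 1 0 * tau + mob_mx m 1 1) ^+ 2).
Proof.
move=> [_ [t [mf [mg [ht [f1 f2 f3] [g1 g2 g3] E]]]]] htau; split=> //.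
have mtau : mob m (Some tau) = Some t.
  apply: (tangency_point_uniq _ ht); have := tangency_point_mob m htau.
  by rewrite /= !mob_circleVK.
exists tau, (mob_comp mf m), (mob_comp mg m).
split; first exact: htau.
- by split; rewrite mob_circle_comp /= mob_circleVK.
- by split; rewrite mob_circle_comp /= mob_circleVK.
(* Applying [mg \o m] to both sides clears the inverse of the composite and leaves a product to
   which [parabolic_conj] applies. *)
apply/funext => x; apply: (@mob_inj _ (mob_comp mg m)).
rewrite /= mobVK !mob_compE /= /mob -!lft_mul ?mob_unit ?parabolic_unit //.
rewrite -mulmxA -(parabolic_conj s mtau).
rewrite mulmxA !lft_mul ?mob_unit ?parabolic_unit //.
by rewrite -E; exact/esym/(mobVK mg).
Qed.

End Tangency.

(** With determinant 1 the difference quotient for a small increment [x != 0] is [1 / ((c * (x +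
    tau) + d) * (c * tau + d))]; then [x] tends to 0. *)
Lemma derive1_lft (K : numFieldType) (a b c d tau : K) :
  a * d - b * c = 1 -> c * tau + d != 0 ->
  derive1 (fun z : K => (a * z + b) / (c * z + d) : K^o) tau =
  ((c * tau + d) ^+ 2)^-1.
Proof.
move=> hdet h.
rewrite /derive1.
apply: cvg_lim; first exact: norm_hausdorff.
have hc : (fun x : K => c * (x + tau) + d : K) @ (0 : K)^' --> c * tau + d.
  rewrite -{2}[tau]add0r; apply: cvgD; last exact: cvg_cst.
  apply: cvgM; first exact: cvg_cst.
  apply: cvgD; last exact: cvg_cst.
  exact: cvg_within.
have hl : (fun x : K => (c * (x + tau) + d)^-1 * (c * tau + d)^-1 : K)
    @ (0 : K)^' --> ((c * tau + d) ^+ 2)^-1.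
  rewrite expr2 invfM; apply: cvgM; last exact: cvg_cst.
  by apply: cvgV.
have hn : \forall x \near (0 : K)^', c * (x + tau) + d != 0.
  exact: cvgr_neq0 hc h.
apply: cvg_trans hl; apply: near_eq_cvg.
near=> x.
have x0 : x != 0 by near: x; exact: nbhs_dnbhs_neq.
have hx : c * (x + tau) + d != 0 by near: x.
rewrite /= /GRing.scale /=.
(* Writing 1 as [a * d - b * c] turns the claim into a plain identity of rational functions. *)
rewrite -[LHS]mul1r -{1}hdet.
by field; rewrite ?hx ?h ?x0.
Unshelve. all: by end_near.
Qed.

Theorem mainTheorem8 (R : realType) (F : discrete_analytic R)
    (a b c d : R[i]) (hdet : a * d - b * c = 1)
    (m : moebius R[i]) (hm : mob_mx m = mx2 a b c d)
    (e : set (circle R)) (he : e = edge (source F))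
    (e'' : set (circle R)) (he'' : e'' = mob_circle (mob_inv m) @` e)
    (tau : R[i])
    (htau : tangency_point (mob_circle (mob_inv m) (cv (source F)))
              (mob_circle (mob_inv m) (cw (source F))) (Some tau))
    (hmtau : mob m (Some tau) <> None) :
  schwarzian (comp_mob F m) e'' = schwarzian F e / (c * tau + d) ^+ 2 /\
  schwarzian F e / (c * tau + d) ^+ 2 =
    schwarzian F (mob_circle m @` e'')
    * derive1 (fun z : R[i] => (a * z + b) / (c * z + d) : R[i]^o) tau.
Proof.
have Ee : mob_circle m @` e'' = e.
  rewrite he'' image_comp (_ : _ \o _ = id) ?image_id //.
  by apply/funext => x /=; exact: mob_circleVK.
have Ee'' : e'' = edge (source (comp_mob F m)).
  by rewrite he'' he /edge /= image_setU !image_set1.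
have v0 : c * tau + d != 0.
  apply/eqP => v0; apply: hmtau.
  by rewrite /mob hm /= !mx2E /proj_point v0 eqxx.
have dm : \det (mob_mx m) = 1 by rewrite hm det_mx2 !mx2E.
(* Since [m] carries [e''] back to [e], the second equality is just the value of the derivative,
   junk case included. *)
split; last by rewrite Ee derive1_lft.
have [[s hs]|no] := pselect (exists s, is_schwarzian F e s).
  rewrite (schwarzianE hs); apply: schwarzianE.
  rewrite he in hs; have := is_schwarzian_comp hs htau.
  by rewrite dm mulr1 hm !mx2E -Ee''.
(* Without a sigma for F there is none for F \o m, since F = (F \o m) \o m^-1;
   both sides are then the junk value 0. *)
rewrite (schwarzian_junk no) mul0r; apply: schwarzian_junk => -[s hs].
apply: no; rewrite Ee'' in hs.
(* Finiteness of [m(tau)] supplies the tangency point needed to go back along [mob_inv m]. *)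
have [t mt] : exists t, mob m (Some tau) = Some t.
  by case: (mob m (Some tau)) hmtau => // t; exists t.
have := is_schwarzian_comp (m := mob_inv m) (tau := t) hs.
rewrite discrete_analytic_comp_mobK -he => H; eexists; apply: H.
by have := tangency_point_mob m htau; rewrite mt !mob_circleVK.
Qed.
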